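(* Let $(G_n)_{n\in\mathbb{N}}$ be an arbitrary family of $3$-regular connected undirected graphs with edge sets $E_n$, and for each $n$ let $\Gamma_n$ be the group of edge flips of $G_n$. There is a constant $c$ such that for every $n\in\mathbb{N}$ and every choice of $u_n\in V(G_n)$, there exists a $\Gamma_n$-symmetric $\vec y$-linear IPS refutation over $\mathbb{F}_2$ of the unsatisfiable system $\mathrm{CFI}(G_n,u_n,1)$ of size at most $c\cdot 2^{|E_n|}$.
   Context: CFI equations: for a $3$-regular connected undirected graph $G=(V,E)$, a vertex $u\in V$ and $a\in\{0,1\}$, $\mathrm{CFI}(G,u,a)$ is the system over $\mathbb{F}_2$ with variables $X=\{x^e_i: e\in E, i\in\mathbb{F}_2\}$ and polynomials: $x^e_i+x^f_j+x^g_k-(i+j+k)$ for every $v\in V\setminus\{u\}$ with $\{e,f,g\}=E(v)$ (the edges incident to $v$) and every $i,j,k\in\mathbb{F}_2$; $x^e_i+x^f_j+x^g_k-(i+j+k+a)$ for $\{e,f,g\}=E(u)$ and every $i,j,k\in\mathbb{F}_2$; $x^e_0+x^e_1-1$ for every $e\in E$; and $x^2-x$ for every $x\in X$. It is unsatisfiable iff $a=1$. The edge-flip group $\Gamma$ is the subgroup of $(\mathbb{F}_2^{E},+)$ of all vectors $\pi$ with $\sum_{e\in E(v)}\pi_e=0$ for every $v\in V$, acting on $X$ by $\pi(x^e_i)=x^e_{i+\pi_e}$; $\mathrm{CFI}(G,u,a)$ is $\Gamma$-invariant. An algebraic circuit over variables $Z$ and field $\mathbb{F}$ is a connected DAG with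 input gates labelled by elements of $Z\cup\mathbb{F}$ and internal gates labelled $+$ or $\times$ (arbitrary fan-in), single output, computing a polynomial. It is $\Gamma$-symmetric (for $\Gamma$ acting on $Z$, trivially on $\mathbb{F}$) if each $\pi\in\Gamma$ extends to a DAG automorphism preserving internal labels and mapping each input gate labelled $z$ to one labelled $\pi(z)$. IPS: for $\mathcal{F}=\{f_1,\dots,f_m\}$ and fresh $Y=\{y_1,\dots,y_m\}$, an IPS certificate is $C(\vec x,\vec y)$ with $C(\vec x,\vec 0)=0$, $C(\vec x,f_1,\dots,f_m)=1$; an IPS refutation is a circuit over $X\uplus Y$ computing one; its size is $\max(\text{number of gates},|X|+|Y|)$; it is $\vec y$-linear if the certificate is $\sum_iy_ig_i(\vec x)$ with $g_i\in\mathbb{F}[X]$. For $\Gamma$-invariant $\mathcal{F}$, $\Gamma$ acts on $Y$ by $\pi(y_i)=y_j$ where $\pi(f_i)=f_j$; a $\Gamma$-symmetric IPS refutation is one that is a $\Gamma$-symmetric circuit w.r.t. this action on $X\uplus Y$. *)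

(* Defs.v *)
From HB Require Import structures.
From mathcomp Require Import all_boot all_order all_fingroup all_algebra.
From mathcomp Require Import finmap.
From mathcomp.multinomials Require Import mpoly.

Set Implicit Arguments.
Unset Strict Implicit.
Unset Printing Implicit Defensive.

Import GRing.Theory.
Local Open Scope ring_scope.

Record sgraph := SGraph {
  vertex :> finType;
  adj : rel vertex;
  adj_sym : ssrbool.symmetric adj;
  adj_irr : irreflexive adj
}.

Definition is_edge (G : sgraph) (e : {set G}) : bool :=
  [exists v : G, exists w : G, adj v w && (e == [set v; w]%SET)].

Definition edge (G : sgraph) : finType := {e : {set G} | is_edge e}.

Definition incident (G : sgraph) (v : G) : {set edge G} :=
  [set e : edge G | v \in val e]%SET.

Definition cubic (G : sgraph) : Prop := forall v : G, #|incident v| = 3%N.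

Definition connected (G : sgraph) : Prop :=
  forall v w : G, connect (@adj G) v w.

(* F[Z] for a finite set Z of variables is {mpoly F[#|Z|]}, the variable z
   being the one whose index is the rank of z in the enumeration of Z. *)
Notation "{ 'polyvar' F [ Z ] }" := {mpoly F[#|Z|]}
  (at level 0, F at level 2, format "{ 'polyvar'  F [ Z ] }") : type_scope.

Section Polynomials.
Variable F : fieldType.

Definition pvar (Z : finType) (z : Z) : {polyvar F[Z]} := 'X_(enum_rank z).

Definition psubst (Z W : finType) (s : Z -> {polyvar F[W]})
    (p : {polyvar F[Z]}) : {polyvar F[W]} :=
  p \mPo [tuple s (enum_val i) | i < #|Z|].

Definition prename (Z W : finType) (s : Z -> W) : {polyvar F[Z]} -> {polyvar F[W]} :=
  psubst (fun z => pvar (s z)).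

End Polynomials.

Inductive gate_label (F Z : Type) :=
  | Var of Z
  | Const of F
  | Plus
  | Times.
Arguments Var {F Z}.
Arguments Const {F Z}.
Arguments Plus {F Z}.
Arguments Times {F Z}.

Definition is_input F Z (l : gate_label F Z) : bool :=
  match l with Var _ | Const _ => true | Plus | Times => false end.

Definition map_label F Z W (s : Z -> W) (l : gate_label F Z) : gate_label F W :=
  match l with
  | Var z => Var (s z)
  | Const c => Const c
  | Plus => Plus
  | Times => Times
  end.

(* [wire g h] means that g is one of the inputs of h; the output is the unique
   gate without outgoing wires. *)
Record circuit (F : fieldType) (Z : finType) := Circuit {
  gate :> finType;
  wire : rel gate;
  label : gate -> gate_label F Z;
  output : gate;
  wire_acyclic : forall g h, wire g h -> ~~ connect wire h g;
  wire_connected : forall g h, connect (fun x y => wire x y || wire y x) g h;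
  is_inputE : forall g, is_input (label g) = [forall h, ~~ wire h g];
  outputE : forall g, (g == output) = [forall h, ~~ wire g h]
}.

Section Circuits.
Variables (F : fieldType) (Z : finType).
Implicit Type C : circuit F Z.

Definition gate_semantics C (val : C -> {polyvar F[Z]}) : Prop :=
  forall g : C, val g =
    match label g with
    | Var z => pvar F z
    | Const c => c%:MP
    | Plus => \sum_(h : C | wire h g) val h
    | Times => \prod_(h : C | wire h g) val h
    end.

(* By acyclicity every circuit has exactly one such [val]. *)
Definition computes C (p : {polyvar F[Z]}) : Prop :=
  exists2 val : C -> {polyvar F[Z]}, gate_semantics val & val (output C) = p.

Lemma gate_semantics_uniq C (val val' : C -> {polyvar F[Z]}) :
  gate_semantics val -> gate_semantics val' -> val =1 val'.
Proof.
move=> vP v'P g; have [n] := ubnP #|[set h : C | connect (@wire F Z C) h g]%SET|.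
elim: n g => // n IHn g le_n.
suff IH (h : C) : wire h g -> val h = val' h.
  by rewrite vP v'P; case: label => // [] //; apply: eq_bigr.
move=> hg; apply: IHn; rewrite -ltnS; apply: leq_trans le_n; rewrite ltnS.
apply: proper_card; apply/properP; split.
  apply/subsetP => x; rewrite !inE => /connect_trans; apply; exact: connect1.
by exists g; rewrite !inE ?connect0 // (wire_acyclic hg).
Qed.

Definition circuit_symmetric (P : finType) (Gamma : {set P})
    (act : P -> Z -> Z) C : Prop :=
  forall pi : P, pi \in Gamma ->
    exists sigma : {perm C},
      (forall g h, wire (sigma g) (sigma h) = wire g h) /\
      (forall g, label (sigma g) = map_label (act pi) (label g)).

End Circuits.

(* The axioms form a finite set Fs of polynomials, and the fresh variables Y
   are indexed by the elements of Fs: the variable y_f is [inr f]. *)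
Section IPS.
Variables (F : fieldType) (X : finType) (Fs : {fset {polyvar F[X]}}).

Definition ips_var : finType := (X + Fs)%type.

Definition ips_certificate (p : {polyvar F[ips_var]}) : Prop :=
  psubst (fun z : ips_var => match z with inl x => pvar F x | inr _ => 0 end) p = 0
  /\
  psubst (fun z : ips_var => match z with inl x => pvar F x | inr f => val f end) p = 1.

Definition ylinear (p : {polyvar F[ips_var]}) : Prop :=
  exists g : Fs -> {polyvar F[X]},
    p = \sum_(f : Fs) pvar F (inr f : ips_var) * prename (inl : X -> ips_var) (g f).

Definition ylinear_ips_refutation (C : circuit F ips_var) : Prop :=
  exists2 p, computes C p & ips_certificate p /\ ylinear p.

Definition ips_size (C : circuit F ips_var) : nat :=
  maxn #|C| (#|X| + #|` Fs|%fset)%N.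

(* y_f is sent to y_f' where f' is the image of f; the default value of insubd
   is never used when Fs is invariant. *)
Definition ips_act (P : finType) (act : P -> X -> X) (pi : P) (z : ips_var) : ips_var :=
  match z with
  | inl x => inl (act pi x)
  | inr f => inr (insubd f (prename (act pi) (val f)))
  end.

Definition system_invariant (P : finType) (Gamma : {set P}) (act : P -> X -> X) : Prop :=
  forall pi, pi \in Gamma -> forall f, f \in Fs -> prename (act pi) f \in Fs.

End IPS.

Section CFI.
Variable G : sgraph.

Definition cfi_var : finType := (edge G * 'F_2)%type.

Definition xvar (e : edge G) (i : 'F_2) : {polyvar 'F_2[cfi_var]} :=
  pvar 'F_2 ((e, i) : cfi_var).

(* Only the values of iota on the edges at v matter: they are the indices
   i, j, k of the three variables. *)
Definition vertex_axiom (u : G) (a : 'F_2) (v : G) (iota : {ffun edge G -> 'F_2}) :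
    {polyvar 'F_2[cfi_var]} :=
  \sum_(e in incident v) xvar e (iota e)
  - (\sum_(e in incident v) iota e + (if v == u then a else 0))%:MP.

Definition edge_axiom (e : edge G) : {polyvar 'F_2[cfi_var]} :=
  xvar e 0 + xvar e 1 - 1.

Definition boolean_axiom (x : cfi_var) : {polyvar 'F_2[cfi_var]} :=
  pvar 'F_2 x ^+ 2 - pvar 'F_2 x.

Definition CFI (u : G) (a : 'F_2) : {fset {polyvar 'F_2[cfi_var]}} :=
  ([fset vertex_axiom u a v iota | v : G, iota : {ffun edge G -> 'F_2}]
  `|` [fset edge_axiom e | e : edge G]
  `|` [fset boolean_axiom x | x : cfi_var])%fset.

Definition edge_flips : {set {ffun edge G -> 'F_2}} :=
  [set pi : {ffun edge G -> 'F_2} |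
    [forall v : G, \sum_(e in incident v) pi e == 0]]%SET.

Definition flip (pi : {ffun edge G -> 'F_2}) (x : cfi_var) : cfi_var :=
  (x.1, x.2 + pi x.1).

End CFI.

Lemma edge_flips_zmod_closed (G : sgraph) : zmod_closed (edge_flips G).
Proof.
split=> [|p q]; rewrite !inE.
  by apply/forallP => v; rewrite big1 // => e _; rewrite ffunE.
move=> /forallP pP /forallP qP; apply/forallP => v.
under eq_bigr do rewrite !ffunE.
by rewrite big_split /= sumrN (eqP (pP v)) (eqP (qP v)) subrr.
Qed.

Section Rename.
Variables (F : fieldType) (Z W : finType) (s : Z -> W).

Lemma prename_var z : prename s (pvar F z) = pvar F (s z).
Proof.
rewrite /prename /psubst /pvar comp_mpolyXU -tnth_nth tnth_mktuple.
by rewrite enum_rankK.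
Qed.

End Rename.

Lemma CFI_invariant (G : sgraph) (u : G) (a : 'F_2) :
  system_invariant (CFI u a) (edge_flips G) (@flip G).
Proof.
move=> pi; rewrite inE => /forallP piP f; rewrite !inE.
have rX e i : prename (flip pi) (xvar e i) = xvar e (i + pi e).
  by rewrite /xvar prename_var.
case/orP => [/orP[]|].
- case/imfset2P => v _ [iota _ ->]; apply/orP; left; apply/orP; left.
  apply/imfset2P; exists v => //; exists (iota + pi) => //.
  rewrite /vertex_axiom /prename /psubst raddfB raddf_sum /= comp_mpolyC.
  congr (_ - _%:MP).
    by apply: eq_bigr => e _; rewrite ffunE; apply: rX.
  congr (_ + _); under [RHS]eq_bigr do rewrite ffunE.
  by rewrite big_split /= (eqP (piP v)) addr0.
- case/imfsetP => e _ ->; apply/orP; left; apply/orP; right.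
  apply/imfsetP; exists e => //.
  rewrite /edge_axiom /prename /psubst raddfB raddfD /= comp_mpoly1.
  have := rX e; rewrite /prename /psubst => rXe; rewrite !rXe; congr (_ - _).
  have -> : (1 + pi e : 'F_2) = pi e + 1 by rewrite addrC.
  rewrite add0r; case: (pi e) => -[|[|//]] lt /=.
    rewrite (_ : Ordinal lt = 0) ?add0r //; exact/val_inj.
  rewrite (_ : Ordinal lt = 1); last exact/val_inj.
  by rewrite addrC; congr (_ + _); congr xvar; apply/val_inj.
- case/imfsetP => x _ ->; apply/orP; right.
  apply/imfsetP; exists (flip pi x) => //.
  rewrite /boolean_axiom /prename /psubst raddfB /= !expr2 rmorphM /=.
  by have := @prename_var 'F_2 _ _ (flip pi) x; rewrite /prename /psubst => ->.
Qed.

(* Main.v *)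
(** Summing the axioms of all vertices for one assignment [iota] of indices to
the edges gives 1: every edge is counted twice and the twist at [u] once.  A
single [iota] breaks the symmetry, and the plain sum over an orbit of the edge
flips vanishes in characteristic 2, so the sum for [iota] is weighted by the
monomial [prod_e x^e_(iota e)].  Over all [iota] the monomials add up to
[prod_e (x^e_0 + x^e_1)], which the edge axioms reduce to 1 by a telescoping
sum along an enumeration of the edges; since flips fix every edge, that
enumeration does not break the symmetry.  There are [2 ^ |E|] assignments, each
costing two gates. *)

From HB Require Import structures.
Require Import Defs.
From mathcomp Require Import all_boot all_order all_fingroup all_algebra.
From mathcomp Require Import finmap zify.
From mathcomp.multinomials Require Import mpoly.

Set Implicit Arguments.
Unset Strict Implicit.
Unset Printing Implicit Defensive.

Import GRing.Theory.
Local Open Scope ring_scope.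

(** * Pruning a wired set of gates to a circuit *)

(* Keeping only the gates from which [o] is reachable makes the circuit
   connected with [o] as its unique sink. *)
Section Prune.
Variables (F : fieldType) (Z T : finType) (w : rel T) (lab : T -> gate_label F Z).
Variables (o : T) (rk : T -> nat).
Hypothesis w_rk : forall g h, w g h -> (rk g < rk h)%N.
Hypothesis inputE : forall g, is_input (lab g) = [forall h, ~~ w h g].

Definition pruned : finType := {g : T | connect w g o}.

Definition pruned_wire (g h : pruned) : bool := w (val g) (val h).

Definition keep (g : T) (go : connect w g o) : pruned := exist _ g go.

Definition pruned_output : pruned := keep (connect0 w o).

Lemma pred_reach (g h : T) : w g h -> connect w h o -> connect w g o.
Proof. by move=> /connect1; apply: connect_trans. Qed.

Lemma pruned_connect_rk (g h : pruned) :
  connect pruned_wire g h -> (rk (val g) <= rk (val h))%N.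
Proof.
case/connectP => p; elim: p g => [g _ -> //|k p IH g /= /andP[gk kp] eq_h].
exact: leq_trans (ltnW (w_rk gk)) (IH _ kp eq_h).
Qed.

Lemma pruned_acyclic (g h : pruned) : pruned_wire g h -> ~~ connect pruned_wire h g.
Proof.
by move=> /w_rk gh; apply/negP => /pruned_connect_rk; rewrite leqNgt gh.
Qed.

(** Every gate on a path to [o] itself reaches [o], so the whole path survives pruning. *)
Lemma pruned_to_output (g : pruned) : connect pruned_wire g pruned_output.
Proof.
case: g => g go; case/connectP: (go) => p.
elim: p g go => [|h p IH] g go /=.
  by move=> _ eq_o; rewrite (_ : exist _ g go = pruned_output) //; apply/val_inj.
case/andP => gh hp eq_o; have ho : connect w h o by apply/connectP; exists p.
apply: connect_trans (IH h ho hp eq_o).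
exact: (@connect1 _ pruned_wire (keep go) (keep ho)).
Qed.

(** With directions forgotten, any two gates are joined through the output. *)
Lemma pruned_connected (g h : pruned) :
  connect (fun x y => pruned_wire x y || pruned_wire y x) g h.
Proof.
set e := (fun _ _ => _).
have to_o k : connect e k pruned_output.
  by apply: connect_sub (pruned_to_output k) => x y xy; apply: connect1; rewrite /e xy.
apply: connect_trans (to_o g) _; rewrite sym_connect_sym // => x y.
by rewrite /e orbC.
Qed.

(** A predecessor of a kept gate reaches [o] through it and is kept too, so no kept gate loses an
    incoming wire. *)
Lemma pruned_inputE (g : pruned) :
  is_input (lab (val g)) = [forall h, ~~ pruned_wire h g].
Proof.
rewrite inputE; apply/forallP/forallP => [no h | no h]; first exact: no.
apply/negP => hg.
by have := no (keep (pred_reach hg (valP g))); rewrite /pruned_wire /= hg.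
Qed.

Lemma pruned_outputE (g : pruned) :
  (g == pruned_output) = [forall h, ~~ pruned_wire g h].
Proof.
apply/eqP/forallP => [-> h | no].
  by apply/negP => /pruned_acyclic; rewrite pruned_to_output.
case/connectP: (pruned_to_output g) => -[|h p] //= /andP[gh _].
by have := no h; rewrite gh.
Qed.

Definition prune : circuit F Z :=
  Circuit pruned_acyclic pruned_connected pruned_inputE pruned_outputE.

Lemma card_prune : (#|prune| <= #|T|)%N.
Proof. by rewrite card_sig max_card. Qed.

Lemma prune_computes (v : T -> {polyvar F[Z]}) :
  (forall g, v g = match lab g with
    | Var z => pvar F z
    | Const c => c%:MP
    | Plus => \sum_(h | w h g) v h
    | Times => \prod_(h | w h g) v h
    end) ->
  computes prune (v o).
Proof.
move=> vE; exists (fun g : prune => v (val g)) => // g.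
rewrite vE /=; case: (lab (val g)) => //.
- rewrite (reindex_omap (val : pruned -> T) insub) => [|h hg].
    by apply: eq_bigl => h; rewrite valK eqxx andbT.
  by rewrite insubT ?(pred_reach hg (valP g)).
- rewrite (reindex_omap (val : pruned -> T) insub) => [|h hg].
    by apply: eq_bigl => h; rewrite valK eqxx andbT.
  by rewrite insubT ?(pred_reach hg (valP g)).
Qed.

(** A wire-preserving map fixing [o] sends paths to [o] to paths to [o], so it restricts to the kept
    gates, where injectivity makes it a permutation. *)
Lemma prune_symmetric (P : finType) (Gamma : {set P}) (act : P -> Z -> Z) :
  (forall pi, pi \in Gamma -> exists s : T -> T,
     [/\ injective s, s o = o, forall g h, w (s g) (s h) = w g h &
         forall g, lab (s g) = map_label (act pi) (lab g)]) ->
  circuit_symmetric Gamma act prune.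
Proof.
move=> symT pi /symT[s [s_inj so sw slab]].
have s_reach g : connect w g o -> connect w (s g) o.
  case/connectP => p; elim: p g => [g _ /= <-|h p IH g /= /andP[gh hp] eq_o].
    by rewrite so connect0.
  by apply: pred_reach (IH _ hp eq_o); rewrite sw.
pose t (g : pruned) : pruned := keep (s_reach _ (valP g)).
have t_inj : injective t by move=> g h /(congr1 val) /= /s_inj /val_inj.
exists (perm t_inj); split=> [g h | g]; rewrite !permE; [exact: sw | exact: slab].
Qed.

End Prune.

(** * Substitution and renaming as ring morphisms *)

Section Substitution.
Variable F : fieldType.

Section Psubst.
Variables (Z W : finType) (s : Z -> {polyvar F[W]}).

HB.instance Definition _ :=
  GRing.RMorphism.copy (psubst s)
    (comp_mpoly [tuple s (enum_val i) | i < #|Z|]).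

Lemma psubst_var z : psubst s (pvar F z) = s z.
Proof. by rewrite /psubst /pvar comp_mpolyXU -tnth_nth tnth_mktuple enum_rankK. Qed.

Lemma psubstC c : psubst s c%:MP = c%:MP.
Proof. exact: comp_mpolyC. Qed.

End Psubst.

Lemma rmorph_eq_on_vars (Z W : finType) (f g : {rmorphism {polyvar F[Z]} -> {polyvar F[W]}}) :
  (forall c, f c%:MP = g c%:MP) -> (forall z, f (pvar F z) = g (pvar F z)) -> f =1 g.
Proof.
move=> fgC fgX p; rewrite [p]mpolyE !rmorph_sum; apply: eq_bigr => m _.
rewrite -mul_mpolyC !rmorphM /= fgC; congr (_ * _).
rewrite mpolyXE_id !rmorph_prod; apply: eq_bigr => i _; rewrite !rmorphXn /=.
by have := fgX (enum_val i); rewrite /pvar enum_valK => ->.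
Qed.

HB.instance Definition _ (Z W : finType) (s : Z -> W) :=
  GRing.RMorphism.copy (@prename F Z W s) (psubst (fun z => pvar F (s z))).

Lemma prenameC (Z W : finType) (s : Z -> W) c : prename s (c%:MP : {polyvar F[Z]}) = c%:MP.
Proof. exact: psubstC. Qed.

Lemma psubst_prename (Z W U : finType) (s : W -> {polyvar F[U]}) (t : Z -> W) p :
  psubst s (prename t p) = psubst (s \o t) p.
Proof.
apply: (rmorph_eq_on_vars (f := psubst s \o prename t) (g := psubst (s \o t))) => [c|z] /=.
  by rewrite prenameC !psubstC.
by rewrite prename_var !psubst_var.
Qed.

Lemma psubst_pvar (Z : finType) (p : {polyvar F[Z]}) : psubst (@pvar F Z) p = p.
Proof.
apply: (rmorph_eq_on_vars (f := psubst (@pvar F Z)) (g := idfun)) => [c|z] /=.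
  by rewrite psubstC.
by rewrite psubst_var.
Qed.

Lemma eq_psubst (Z W : finType) (s t : Z -> {polyvar F[W]}) :
  s =1 t -> psubst s =1 psubst t.
Proof.
move=> st; apply: rmorph_eq_on_vars => [c|z] /=; first by rewrite !psubstC.
by rewrite !psubst_var.
Qed.

Lemma prename_involutive (Z : finType) (s : Z -> Z) :
  involutive s -> involutive (@prename F Z Z s).
Proof.
move=> sK p; rewrite {1}/prename psubst_prename -[RHS]psubst_pvar.
by apply: eq_psubst => z /=; rewrite sK.
Qed.

End Substitution.

(** * Closure properties of linearity in the axiom variables *)

Section YLinear.
Variables (F : fieldType) (X : finType) (Fs : {fset {polyvar F[X]}}).

Local Notation Z := (ips_var Fs).
Local Notation lift := (prename (inl : X -> Z)).

Lemma ylinear_var (f : Fs) : ylinear (pvar F (inr f : Z)).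
Proof.
exists (fun f' => if f' == f then 1 else 0); rewrite (bigD1 f) //= eqxx rmorph1 mulr1.
by rewrite big1 ?addr0 // => f' /negPf->; rewrite rmorph0 mulr0.
Qed.

Lemma ylinear_sum (I : finType) (p : I -> {polyvar F[Z]}) :
  (forall i, ylinear (p i)) -> ylinear (\sum_i p i).
Proof.
move=> /fin_all_exists[g gP]; exists (fun f => \sum_i g i f).
under eq_bigr do rewrite gP; rewrite exchange_big; apply: eq_bigr => f _.
by rewrite rmorph_sum mulr_sumr.
Qed.

Lemma ylinearD (p q : {polyvar F[Z]}) : ylinear p -> ylinear q -> ylinear (p + q).
Proof.
move=> [g ->] [h ->]; exists (fun f => g f + h f); rewrite -big_split.
by apply: eq_bigr => f _; rewrite rmorphD mulrDr.
Qed.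

Lemma ylinear_mul (q : {polyvar F[X]}) (p : {polyvar F[Z]}) :
  ylinear p -> ylinear (lift q * p).
Proof.
move=> [g ->]; exists (fun f => q * g f); rewrite mulr_sumr.
by apply: eq_bigr => f _; rewrite rmorphM mulrCA.
Qed.

(** Each summand carries a factor [y_f], which is set to 0. This settles the first condition on a
    certificate. *)
Lemma ylinear_vanish (p : {polyvar F[Z]}) : ylinear p ->
  psubst (fun z : Z => match z with inl x => pvar F x | inr _ => 0 end) p = 0.
Proof.
move=> [g ->]; rewrite rmorph_sum big1 // => f _.
by rewrite rmorphM /= psubst_var mul0r.
Qed.

End YLinear.

(** * Characteristic two and the telescoping product *)

Lemma F2_mpoly_addrr (Z : finType) (p : {polyvar 'F_2[Z]}) : p + p = 0.
Proof. by rewrite -mulr2n -scaler_nat (_ : 2%:R = 0) ?scale0r //; apply/val_inj. Qed.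

Lemma F2_addrr (i : 'F_2) : i + i = 0.
Proof. by apply/addrr_pchar2/pchar_Fp. Qed.

Lemma F2_sum (V : nmodType) (h : 'F_2 -> V) : \sum_i h i = h 0 + h 1.
Proof.
by rewrite !big_ord_recl big_ord0 addr0; congr (h _ + h _); apply/val_inj.
Qed.

(** Multiplying the product of the factors before [i] by [1 + f i] adds [f i] times that product;
    the increments accumulate from the empty product 1. *)
Lemma prod_add1_telescope (R : comPzRingType) (n : nat) (f : 'I_n -> R) :
  \prod_i (1 + f i) = 1 + \sum_i f i * \prod_(j < n | (j < i)%N) (1 + f j).
Proof.
elim: n f => [|n IH] f; first by rewrite !big_ord0 addr0.
(* For [i <= n] the condition [j < i] excludes the last index, so the product already lives on
   ['I_n]. *)
have widenE i : (i <= n)%N -> \prod_(j < n.+1 | (j < i)%N) (1 + f j) =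
    \prod_(j < n | (j < i)%N) (1 + f (widen_ord (leqnSn n) j)).
  move=> le_in; rewrite big_mkcond big_ord_recr /= ltnNge le_in mulr1.
  by rewrite -big_mkcond.
rewrite !big_ord_recr /= IH mulrDr mulr1 -addrA; congr (_ + (_ + _)).
  by apply: eq_bigr => i _; rewrite widenE // ltnW.
rewrite mulrC -IH widenE //; congr (_ * _).
by apply: eq_bigl => j; rewrite /= ltn_ord.
Qed.

Lemma prod_add1_telescope_rank (R : comPzRingType) (E : finType) (f : E -> R) :
  \prod_e (1 + f e) =
  1 + \sum_e f e * \prod_(e' | (enum_rank e' < enum_rank e)%N) (1 + f e').
Proof.
rewrite (reindex _ (onW_bij _ (enum_val_bij E))) prod_add1_telescope; congr (1 + _).
rewrite [RHS](reindex _ (onW_bij _ (enum_val_bij E))); apply: eq_bigr => i _.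
rewrite [in RHS](reindex _ (onW_bij _ (enum_val_bij E))); congr (_ * _).
by apply: eq_bigl => j; rewrite !enum_valK.
Qed.

(** * Double counting in cubic graphs *)

Section Graph.
Variable G : sgraph.

Lemma card_edge (e : edge G) : #|val e| = 2%N.
Proof.
case: e => e /= /existsP[v /existsP[w /andP[vw /eqP->]]]; rewrite cards2.
by case: eqP vw => // ->; rewrite adj_irr.
Qed.

(** Each edge has two endpoints. Values in any commutative monoid let one identity serve both
    counting in [nat] and cancellation over ['F_2]. *)
Lemma handshake (V : nmodType) (h : edge G -> V) :
  \sum_v \sum_(e in incident v) h e = \sum_e h e *+ 2.
Proof.
rewrite (exchange_big_dep predT) //=; apply: eq_bigr => e _.
rewrite (eq_bigl (mem (val e))) => [|v]; last by rewrite inE.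
by rewrite sumr_const card_edge.
Qed.

Hypothesis G_cubic : cubic G.

Lemma cubic_handshake : (3 * #|G| = 2 * #|edge G|)%N.
Proof.
have := handshake (fun=> 1%N).
under eq_bigr do rewrite sumr_const G_cubic.
rewrite !sumr_const -!mulrnA => /eqP; rewrite !natn => /eqP.
by rewrite mulnC => ->; rewrite mulnC.
Qed.

(** An edge incident to two distinct vertices is the pair of them, so they share at most one edge,
    whereas equal incidence sets would make them share three. *)
Lemma incident_inj : injective (@incident G).
Proof.
move=> v w eq_vw; apply/eqP; apply: contraT => neq_vw.
suff /subset_leq_card : incident v \subset [pred e : edge G | val e == [set v; w]%SET].
  rewrite G_cubic => /leq_trans le3; apply: (le3 1%N).
  apply/card_le1P => e; rewrite inE => /eqP ee e'; rewrite !inE -ee.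
  by rewrite (inj_eq val_inj).
apply/subsetP => e ev; have ew : e \in incident w by rewrite -eq_vw.
rewrite !inE eq_sym eqEcard subUset !sub1set card_edge cards2 neq_vw.
by move: ev ew; rewrite !inE => -> ->.
Qed.

End Graph.

(** * Number of variables and axioms *)

Section CFISize.
Variable G : sgraph.
Hypothesis G_cubic : cubic G.
Variables (u : G) (a : 'F_2).

(** An axiom at [v] depends only on [iota] at the three edges there, so [iota] may be taken to
    vanish elsewhere; this leaves 8 choices per vertex. *)
Lemma card_vertex_axioms :
  (#|` [fset vertex_axiom u a v iota | v : G, iota : {ffun edge G -> 'F_2}]%fset|
    <= 8 * #|G|)%N.
Proof.
pose S := [set p : G * {ffun edge G -> 'F_2} |
  p.2 \in pffun_on 0 (mem (incident p.1)) predT]%SET.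
have cardS : #|S| = (8 * #|G|)%N.
  rewrite -sum1_card (eq_bigl (fun p => xpredT p.1 &&
    (p.2 \in pffun_on 0 (mem (incident p.1)) predT))); last by move=> p; rewrite inE.
  rewrite -(pair_big_dep xpredT (fun v i => i \in pffun_on 0 (mem (incident v)) predT)
    (fun _ _ => 1%N)) /=.
  under eq_bigr do rewrite sum1_card card_pffun_on G_cubic card_ord.
  by rewrite sum_nat_const mulnC.
rewrite -cardS cardE.
have := leq_imfset_card imfset_key (fun p => vertex_axiom u a p.1 p.2) (mem S).
apply: leq_trans.
apply: fsubset_leq_card; apply/fsubsetP => f /imfset2P[v _ [i _ ->]].
pose j := [ffun e => if e \in incident v then i e else 0].
apply/imfsetP; exists (v, j) => /=.
  rewrite inE; apply/pffun_onP; split=> //; apply/subsetP => e /=.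
  by rewrite inE ffunE; case: ifP => //; rewrite eqxx.
rewrite /vertex_axiom; congr (_ - (_ + _)%:MP);
  by apply: eq_bigr => e ev; rewrite ffunE ev.
Qed.

(** With [3|V| = 2|E|] the [8|V|] vertex axioms number [16/3 |E|]; the variables, edge axioms and
    Boolean axioms add [(2 + 1 + 2)|E|]. *)
Lemma card_CFI : (#|cfi_var G| + #|` CFI u a| <= 11 * #|edge G|)%N.
Proof.
have cX : #|cfi_var G| = (2 * #|edge G|)%N by rewrite card_prod card_ord mulnC.
have cE : (#|` [fset edge_axiom e | e : edge G]%fset| <= #|edge G|)%N.
  by rewrite (leq_trans (leq_imfset_card _ _ _)) //= cardE.
have cB : (#|` [fset boolean_axiom x | x : cfi_var G]%fset| <= #|cfi_var G|)%N.
  by rewrite (leq_trans (leq_imfset_card _ _ _)) //= cardE.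
have cV := card_vertex_axioms; have := cubic_handshake G_cubic.
rewrite /CFI => hs.
set V := imfset2 _ _ _ _ in cV *; set E := imfset _ _ _ in cE *.
set B := imfset _ _ _ in cB *.
have le1 := cardfsUI (V `|` E)%fset B; have le2 := cardfsUI V E.
lia.
Qed.

End CFISize.

(** * Edge flips acting on the axioms *)

Section Flip.
Variables (G : sgraph) (u : G) (a : 'F_2).
Implicit Types (pi iota : {ffun edge G -> 'F_2}).

Lemma flipK pi : involutive (flip pi).
Proof. by case=> e i; rewrite /flip /= -addrA F2_addrr addr0. Qed.

(** The constant term survives the shift of indices because [pi] sums to zero around [v]. *)
Lemma prename_vertex_axiom pi v iota : pi \in edge_flips G ->
  prename (flip pi) (vertex_axiom u a v iota) = vertex_axiom u a v (iota + pi).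
Proof.
rewrite inE => /forallP piP; rewrite /vertex_axiom rmorphB rmorph_sum /=.
rewrite prenameC; congr (_ - _%:MP).
  by apply: eq_bigr => e _; rewrite /xvar prename_var ffunE.
congr (_ + _); under [RHS]eq_bigr do rewrite ffunE.
by rewrite big_split /= (eqP (piP v)) addr0.
Qed.

(** A sum over all of ['F_2] can be reindexed by a shift and distributed over assignments. *)
Lemma edge_axiomE (e : edge G) : edge_axiom e = \sum_i xvar e i - 1.
Proof. by rewrite F2_sum. Qed.

Lemma prename_edge_axiom pi (e : edge G) :
  prename (flip pi) (edge_axiom e) = edge_axiom e.
Proof.
rewrite !edge_axiomE rmorphB rmorph1 rmorph_sum; congr (_ - _).
rewrite [RHS](reindex_inj (addIr (pi e))); apply: eq_bigr => i _.
by rewrite /= /xvar prename_var.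
Qed.

Lemma sum_vertex_axioms iota : \sum_v vertex_axiom u a v iota = a%:MP.
Proof.
rewrite /vertex_axiom big_split /= sumrN handshake.
rewrite big1 => [|e _]; last exact: F2_mpoly_addrr.
rewrite add0r -rmorph_sum big_split /= handshake big1 => [|e _]; last exact: F2_addrr.
(* What remains is [- a%:MP], which equals [a%:MP] in characteristic 2. *)
by rewrite add0r -big_mkcond big_pred1_eq -[LHS]addr0 -(F2_mpoly_addrr a%:MP) addKr.
Qed.

(** The linear coefficient at [x^e_(iota e)] tells whether [e] is incident to the vertex. Hence the
    axioms of one assignment stay distinct, and a gate wired to this set of axioms receives exactly
    one wire per vertex. *)
Lemma vertex_axiom_inj iota : cubic G -> injective (fun v => vertex_axiom u a v iota).
Proof.
move=> G_cubic v w /= eq_vw; apply: incident_inj => //; apply/setP => e.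
have coefE x : (vertex_axiom u a x iota)@_U_(enum_rank ((e, iota e) : cfi_var G))
    = (e \in incident x)%:R.
  rewrite /vertex_axiom mcoeffB mcoeffC mnm1_eq0 mulr0 subr0 raddf_sum /=.
  rewrite big_mkcond (bigD1 e) //= big1 ?addr0 => [|e' ne]; last first.
    case: ifP => // _; rewrite mcoeffXU (inj_eq enum_rank_inj).
    by rewrite xpair_eqE (negPf ne).
  by case: ifP => // _; rewrite mcoeffXU eqxx.
have := coefE v; rewrite eq_vw coefE.
by case: (e \in _); case: (e \in _) => // /(congr1 val).
Qed.

End Flip.

Lemma big_graph (R : Type) (idx : R) (op : Monoid.com_law idx)
    (I J : finType) (h : I -> J) (f : I * J -> R) :
  \big[op/idx]_(x | x.2 == h x.1) f x = \big[op/idx]_i f (i, h i).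
Proof.
rewrite (eq_bigr (fun x => f (x.1, x.2))) => [|[] //].
rewrite -(pair_big_dep xpredT (fun i j => j == h i) (fun i j => f (i, j))) /=.
by apply: eq_bigr => i _; rewrite big_pred1_eq.
Qed.

(** * The certificate *)

Section Refutation.
Variables (G : sgraph) (u : G).
Hypothesis G_cubic : cubic G.

Local Notation Fs := (CFI u 1).
Local Notation Z := (ips_var Fs).
Local Notation assignment := {ffun edge G -> 'F_2}.

Lemma vertex_axiom_in v (iota : assignment) : vertex_axiom u 1 v iota \in Fs.
Proof.
by rewrite !inE; apply/orP; left; apply/orP; left; apply/imfset2P; exists v => //; exists iota.
Qed.

Lemma edge_axiom_in (e : edge G) : edge_axiom e \in Fs.
Proof. by rewrite !inE; apply/orP; left; apply/orP; right; apply/imfsetP; exists e. Qed.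

Definition vax v iota : Fs := FSetSub (vertex_axiom_in v iota).
Definition eax e : Fs := FSetSub (edge_axiom_in e).

Local Notation X x := (pvar 'F_2 (inl x : Z)).
Local Notation Y f := (pvar 'F_2 (inr f : Z)).

Definition edge_sum (e : edge G) : {polyvar 'F_2[Z]} := \sum_i X (e, i).

(** A summand of the telescoped [\prod_e (1 + edge_axiom e)]. Only the leading factor becomes a [y]
    variable; the others stay [x^e_0 + x^e_1], which keeps the term linear in [y]. *)
Definition edge_term (e : edge G) : {polyvar 'F_2[Z]} :=
  Y (eax e) * \prod_(e' | (enum_rank e' < enum_rank e)%N) edge_sum e'.

Definition vertex_sum (iota : assignment) : {polyvar 'F_2[Z]} := \sum_v Y (vax v iota).

Definition assignment_term (iota : assignment) : {polyvar 'F_2[Z]} :=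
  (\prod_e X (e, iota e)) * vertex_sum iota.

Definition cfi_certificate : {polyvar 'F_2[Z]} :=
  \sum_e edge_term e + \sum_iota assignment_term iota.

Lemma cfi_certificate_ylinear : ylinear cfi_certificate.
Proof.
have liftX (x : cfi_var G) : X x = prename (inl : cfi_var G -> Z) (pvar 'F_2 x).
  by rewrite prename_var.
apply: ylinearD.
  apply: ylinear_sum => e; rewrite /edge_term mulrC /edge_sum.
  under eq_bigr => e' _ do (under eq_bigr => i _ do rewrite liftX; rewrite -rmorph_sum).
  by rewrite -rmorph_prod; apply/ylinear_mul/ylinear_var.
apply: ylinear_sum => iota; rewrite /assignment_term; under eq_bigr do rewrite liftX; rewrite -rmorph_prod.
by apply: ylinear_mul; apply: ylinear_sum => v; apply: ylinear_var.
Qed.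

(* The monomials of the assignments add up to the product of the edge sums
   x^e_0 + x^e_1, which the edge terms telescope to 1. *)
Lemma cfi_certificateP : ips_certificate cfi_certificate.
Proof.
split; first exact/ylinear_vanish/cfi_certificate_ylinear.
set s := fun z : Z => _.
have sums e : psubst s (edge_sum e) = 1 + edge_axiom e.
  rewrite edge_axiomE addrC subrK rmorph_sum; apply: eq_bigr => i _.
  by rewrite /= psubst_var.
have -> : psubst s cfi_certificate =
    \sum_e edge_axiom e * \prod_(e' | (enum_rank e' < enum_rank e)%N) (1 + edge_axiom e')
    + \prod_(e : edge G) (1 + edge_axiom e).
  rewrite /cfi_certificate rmorphD !rmorph_sum /=; congr (_ + _).
    apply: eq_bigr => e _; rewrite rmorphM /= psubst_var rmorph_prod /=.
    by congr (_ * _); apply: eq_bigr.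
  under [RHS]eq_bigr do rewrite edge_axiomE addrC subrK.
  (* Expanding the product of edge sums chooses one index per edge, hence one monomial per
     assignment. *)
  rewrite bigA_distr_bigA; apply: eq_bigr => iota _.
  rewrite rmorphM /= rmorph_prod /= rmorph_sum /=.
  under [W in _ * W]eq_bigr do rewrite psubst_var /=.
  (* The vertex axioms of an assignment add up to the twist 1, leaving its bare monomial. *)
  rewrite sum_vertex_axioms mulr1; apply: eq_bigr => e _.
  by rewrite psubst_var.
(* The product is 1 plus the telescoping sum, which cancels against its other copy in characteristic
   2. *)
by rewrite prod_add1_telescope_rank addrC -addrA F2_mpoly_addrr addr0.
Qed.

(** * The symmetric circuit *)

Definition cfi_gate : finType :=
  ((Z + (edge G + edge G)) + ((assignment + assignment) + unit))%type.

Local Notation gx x := (inl (inl (inl x))).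
Local Notation gy f := (inl (inl (inr f))).
Local Notation gsum e := (inl (inr (inl e))).
Local Notation gterm e := (inl (inr (inr e))).
Local Notation gvert i := (inr (inl (inl i))).
Local Notation gassign i := (inr (inl (inr i))).
Local Notation gout := (inr (inr tt)).

Definition cfi_wire (g h : cfi_gate) : bool :=
  match g, h with
  | gx x, gsum e => x.1 == e
  | gx x, gassign i => x.2 == i x.1
  | gy f, gterm e => f == eax e
  | gy f, gvert i => [exists v, f == vax v i]
  | gsum e', gterm e => (enum_rank e' < enum_rank e)%N
  | gvert j, gassign i => j == i
  | gterm _, gout => true
  | gassign _, gout => true
  | _, _ => false
  end.

Definition cfi_label (g : cfi_gate) : gate_label 'F_2 Z :=
  match g with
  | inl (inl z) => Var z
  | gsum _ => Plus
  | gterm _ => Times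
  | gvert _ => Plus
  | gassign _ => Times
  | _ => Plus
  end.

Definition cfi_rank (g : cfi_gate) : nat :=
  match g with
  | inl (inl _) => 0
  | gsum _ => 1
  | gterm _ => 2
  | gvert _ => 1
  | gassign _ => 2
  | _ => 3
  end.

Lemma cfi_wire_rank g h : cfi_wire g h -> (cfi_rank g < cfi_rank h)%N.
Proof. by case: g => [[[x|f]|[e|e]]|[[i|i]|[]]]; case: h => [[[x'|f']|[e'|e']]|[[i'|i']|[]]]. Qed.

(** Each internal gate needs a predecessor: [u] provides one for the vertex sums and the zero
    assignment one for the output. *)
Lemma cfi_inputE g : is_input (cfi_label g) = [forall h, ~~ cfi_wire h g].
Proof.
have inner g' h : cfi_wire h g' -> false = [forall h, ~~ cfi_wire h g'].
  by move=> hg; apply/esym/forallP => /(_ h); rewrite hg.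
case: g => [[[x|f]|[e|e]]|[[i|i]|[]]] /=.
- by apply/esym/forallP => -[[[y|f]|[e|e]]|[[i|i]|[]]].
- by apply/esym/forallP => -[[[y|f']|[e|e]]|[[i|i]|[]]].
- by apply: (inner _ (gx (e, 0))); rewrite /= eqxx.
- by apply: (inner _ (gy (eax e))); rewrite /= eqxx.
- by apply: (inner _ (gy (vax u i))); apply/existsP; exists u.
- by apply: (inner _ (gvert i)); rewrite /= eqxx.
- by apply: (inner _ (gassign 0)).
Qed.

(** Pruning matters: the [y] variables of Boolean axioms and the sum gate of the last edge feed no
    gate, so they would be further sinks. *)
Definition cfi_circuit : circuit 'F_2 Z := prune gout cfi_wire_rank cfi_inputE.

Definition cfi_value (g : cfi_gate) : {polyvar 'F_2[Z]} :=
  match g with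
  | inl (inl z) => pvar 'F_2 z
  | gsum e => edge_sum e
  | gterm e => edge_term e
  | gvert i => vertex_sum i
  | gassign i => assignment_term i
  | _ => cfi_certificate
  end.

Lemma vax_inj iota : injective (vax^~ iota).
Proof. by move=> v w /(congr1 val) /= /vertex_axiom_inj; apply. Qed.

Lemma cfi_circuit_computes : computes cfi_circuit cfi_certificate.
Proof.
apply: (@prune_computes _ _ _ _ _ _ _ _ _ cfi_value).
case=> [[[x|f]|[e|e]]|[[i|i]|[]]] //=; rewrite !big_sumType /= ?big_pred0_eq.
- rewrite !addr0 /edge_sum (eq_bigl (fun x => (x.1 == e) && xpredT x.2)) => [|x]; last first.
    by rewrite andbT.
  rewrite (eq_bigr (fun x => X (x.1, x.2))) => [|[] //].
  by rewrite -(pair_big (pred1 e) xpredT (fun e' i => X (e', i))) /= big_pred1_eq.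
- by rewrite big_pred1_eq !mul1r !mulr1.
- rewrite !add0r !addr0 /vertex_sum.
  (* The inverse picks the vertex of an axiom, unique by [vax_inj]; the default [u] is never
     reached, since every wired [f] has the form [vax v i]. *)
  rewrite (reindex_onto (vax^~ i) (fun f => odflt u [pick v | f == vax v i])) /=.
    apply: eq_bigl => v; rewrite (introT existsP); last by exists v.
    case: pickP => [w /eqP/vax_inj -> /= |/(_ v)]; by rewrite eqxx.
  move=> f /existsP[v fv]; case: pickP => [w /eqP -> //|/(_ v)].
  by rewrite fv.
- by rewrite big_pred1_eq !mul1r !mulr1 big_graph.
- by rewrite !add0r !addr0.
Qed.

(** Flipping the variables turns the monomial of [i] into that of [i + pi], while each edge keeps
    its pair of variables and its rank. *)
Definition gate_flip (pi : assignment) (g : cfi_gate) : cfi_gate :=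
  match g with
  | inl (inl z) => inl (inl (ips_act (@flip G) pi z))
  | gvert i => gvert (i + pi)
  | gassign i => gassign (i + pi)
  | _ => g
  end.

Lemma cfi_circuit_symmetric :
  circuit_symmetric (edge_flips G) (ips_act (@flip G)) cfi_circuit.
Proof.
apply: prune_symmetric => pi piG; exists (gate_flip pi).
(* Invariance of the system rules out the default value of [insubd]. *)
have actE (f : Fs) : val (insubd f (prename (flip pi) (val f))) = prename (flip pi) (val f).
  exact: insubdK (CFI_invariant piG (valP f)).
(* Being an involution makes the action injective, so wires defined by equality of axioms are
   preserved. *)
have actK : involutive (fun f : Fs => insubd f (prename (flip pi) (val f))).
  by move=> f; apply/val_inj; rewrite !actE prename_involutive //; apply: flipK.
have pipi (i : assignment) : i + pi + pi = i.
  by apply/ffunP => e; rewrite !ffunE -addrA F2_addrr addr0.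
have act_eax e : insubd (eax e) (prename (flip pi) (val (eax e))) = eax e.
  by apply/val_inj; rewrite actE /= prename_edge_axiom.
have act_vax v i : insubd (vax v i) (prename (flip pi) (val (vax v i))) = vax v (i + pi).
  by apply/val_inj; rewrite actE /= prename_vertex_axiom.
split=> //.
- apply: (can_inj (g := gate_flip pi)).
  case=> [[[x|f]|[e|e]]|[[i|i]|[]]] //=; rewrite ?flipK ?actK ?pipi //.
- case=> [[[x|f]|[e|e]]|[[i|i]|[]]]; case=> [[[x'|f']|[e'|e']]|[[i'|i']|[]]] //=.
  + by rewrite ffunE (inj_eq (addIr _)).
  + by rewrite -{1}act_eax (inj_eq (inv_inj actK)).
  + by apply: eq_existsb => v; rewrite -act_vax (inj_eq (inv_inj actK)).
  + by rewrite (inj_eq (addIr _)).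
- by case=> [[[x|f]|[e|e]]|[[i|i]|[]]].
Qed.

(** There are at most [11|E|] variable gates, [2|E|] edge gates, [2 * 2^|E|] assignment gates and
    one output; [|E| < 2^|E|] brings the total below [16 * 2^|E|]. *)
Lemma cfi_circuit_size : (ips_size cfi_circuit <= 16 * 2 ^ #|edge G|)%N.
Proof.
have sizeZ := card_CFI G_cubic u 1.
have cardA : #|{: assignment}| = (2 ^ #|edge G|)%N by rewrite card_ffun card_ord.
have leE : (#|edge G| < 2 ^ #|edge G|)%N by apply: ltn_expl.
rewrite /ips_size geq_max; apply/andP; split.
  apply: leq_trans (card_prune _ _ _) _.
  rewrite !card_sum cardA card_unit -cardfE.
  rewrite -addnA; apply: leq_trans (leq_add sizeZ (leqnn _)) _.
  by move: #|edge G| (2 ^ #|edge G|)%N leE; lia.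
by apply: leq_trans sizeZ _; rewrite leq_mul // ltnW.
Qed.

End Refutation.

Theorem theorem6p3 (G : nat -> sgraph)
    (G_cubic : forall n : nat, cubic (G n))
    (G_connected : forall n : nat, connected (G n)) :
  exists c : nat, forall (n : nat) (u : G n),
    exists C : circuit 'F_2 (ips_var (CFI u 1%R)),
      ylinear_ips_refutation C /\
      circuit_symmetric (edge_flips (G n)) (ips_act (@flip (G n))) C /\
      (ips_size C <= c * 2 ^ #|edge (G n)|)%N.
Proof.
exists 16 => n u; exists (cfi_circuit u); split; last split.
- exists (cfi_certificate u); first exact: cfi_circuit_computes.
  by split; [exact: cfi_certificateP | exact: cfi_certificate_ylinear].
- exact: cfi_circuit_symmetric.
- exact: cfi_circuit_size.
Qed.
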